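(* For $n \ge 3$, the cycle $C_n$ is $\gamma_{\rm tg}$-critical if and only if $n \pmod 6 \in \{0,1,3\}$.
   Context: Total domination game on a graph $G$ (without isolated vertices): two players, Dominator and Staller, alternately choose vertices of $G$; a chosen vertex must totally dominate (i.e., be adjacent to) at least one vertex not yet totally dominated by previously chosen vertices (a legal move); the game ends when no legal move exists. Dominator wants to minimize and Staller to maximize the number of moves. $\gamma_{\rm tg}(G)$ is the number of moves when Dominator moves first and both play optimally. For a vertex $v$, $G|v$ denotes the partially total dominated graph in which $v$ is declared already totally dominated (it need not be totally dominated during the game, and a move is legal only if it totally dominates some vertex that is not yet totally dominated and not declared so); $\gamma_{\rm tg}(G|v)$ is the number of moves in the Dominator-start game on $G|v$ under optimal play. $G$ is $\gamma_{\rm tg}$-critical if $\gamma_{\rm tg}(G|v) < \gamma_{\rm tg}(G)$ for every $v \in V(G)$. *)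

(* Defs.v *)
From mathcomp Require Import all_boot.
Set Implicit Arguments. Unset Strict Implicit. Unset Printing Implicit Defensive.

(* A graph on a finite vertex type T is given by an adjacency relation e
   (for the cycle below it is symmetric and irreflexive). *)
Section TDGame.
Variables (T : finType) (e : rel T).

Definition nbhd (v : T) : {set T} := [set u | e v u].

(* D = set of vertices already totally dominated or declared so.
   A move v is legal iff it totally dominates some vertex not in D. *)
Definition legal (D : {set T}) (v : T) : bool := ~~ (nbhd v \subset D).

(* Number of remaining moves under optimal play, with fuel k.
   b = true : Dominator (minimizer) to move; b = false : Staller (maximizer). *)
Fixpoint game_val (k : nat) (b : bool) (D : {set T}) : nat :=
  match k with
  | 0 => 0
  | k'.+1 =>
    if [exists v, legal D v] then
      if b then
        (\big[minn/#|T|.+1]_(v | legal D v) game_val k' false (D :|: nbhd v)).+1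
      else
        (\max_(v | legal D v) game_val k' true (D :|: nbhd v)).+1
    else 0
  end.

(* Each legal move adds at least one vertex to D, so #|T| fuel suffices. *)
Definition gamma_tg_part (S : {set T}) : nat := game_val #|T| true S.

Definition gamma_tg : nat := gamma_tg_part set0.

Definition gamma_tg_critical : Prop :=
  forall v : T, gamma_tg_part [set v] < gamma_tg.
End TDGame.

Definition cycle_rel (n : nat) : rel 'I_n :=
  fun i j => (val j == i.+1 %% n) || (val i == j.+1 %% n).
Arguments cycle_rel n : clear implicits.

(* Main.v *)
(* The neighbourhoods of the cycle are the pairs {x, x + 2}, so the game is an
   edge covering game on the orbits of x |-> x + 2: one n-cycle if n is odd, two
   n/2-cycles if n is even. A move covers one or two new vertices. Dominator
   shortens a run of at least two uncovered vertices from its end, which lowers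
   the weight (twice the number of uncovered vertices, plus the number of runs)
   by at least 4, while every move lowers it by at least 2. Staller covers a
   single vertex at the end of a run, which is possible unless all uncovered
   vertices form a full orbit. So Dominator can force each round to lower the
   weight by 6, and Staller can force it to cover at most 3 vertices; the two
   bounds agree up to the effect of an orbit not yet opened, which depends on
   its length modulo 3. *)
Require Import Defs.
From mathcomp Require Import all_boot.
From mathcomp Require Import zify.

Set Implicit Arguments. Unset Strict Implicit. Unset Printing Implicit Defensive.

(** * Iterated minima and the arithmetic of the bounding functions *)

Lemma bigmin_leq (I : finType) (P : pred I) (F : I -> nat) (d : nat) (i : I) :
  P i -> \big[minn/d]_(j | P j) F j <= F i.
Proof.
rewrite -big_filter => Pi.
have: i \in [seq j <- index_enum I | P j] by rewrite mem_filter Pi mem_index_enum.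
elim: [seq _ <- _ | _] => //= j r IHr; rewrite inE big_cons geq_min.
by case/predU1P=> [-> | /IHr ->]; rewrite ?leqnn ?orbT.
Qed.

(* Bounds for positions in which an orbit of m vertices is untouched, in terms
   of the weight p, resp. of the number u of uncovered vertices. The recursions
   lowerD_step and lowerS_step with the constraint lowerS_touch, where Staller
   is forced to open that orbit, determine the residues in lowerD and lowerS. *)
Definition upper (m p : nat) : nat := p %/ 6 + (p + nth 0 [:: 3; 4; 2] (m %% 3)) %/ 6.

Lemma upper_add6 m p : upper m (p + 6) = (upper m p).+2.
Proof. rewrite /upper; lia. Qed.

Lemma upper_mono m p q : p <= q -> upper m p <= upper m q.
Proof. rewrite /upper; lia. Qed.

(** For the case that Staller opens the untouched orbit after Dominator has shortened a run: the two
    moves lower the weight by 4 + 3 = 7, one more than the 6 that a round is charged. *)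
Lemma upper_ge m p : (p - 1) %/ 3 <= upper m p.
Proof.
rewrite /upper; have : m %% 3 < 3 by rewrite ltn_mod.
by case: (m %% 3) => [|[|[|//]]] _ /=; lia.
Qed.

(** For positions whose runs are single vertices, where opening the orbit ends a round that may
    lower the weight by only 6; the congruence makes up for the missing unit. *)
Lemma upper_ge_mod m p : p = 2 * m %[mod 3] -> p %/ 3 <= upper m p.
Proof.
rewrite /upper => pE.
have [r_lt mE] : m %% 3 < 3 /\ p %% 3 = (2 * (m %% 3)) %% 3 by lia.
by move: r_lt mE; case: (m %% 3) => [|[|[|//]]] _ /=; lia.
Qed.

(** For the position in which only the untouched orbit remains, of weight [2 * m]. *)
Lemma upper_double m : (2 * m + 1) %/ 3 <= upper m (2 * m).
Proof.
rewrite /upper; have : m %% 3 = m %% 3 by [].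
have : m %% 3 < 3 by rewrite ltn_mod.
by case: {1 3 4}(m %% 3) => [|[|[|//]]] _ /=; lia.
Qed.

Definition lowerD (m u : nat) : nat := nth 0
  [:: (2 * u + 1) %/ 3; 2 * ((u + 2) %/ 3) - 1; 2 * u %/ 3] (m %% 3).

Definition lowerS (m u : nat) : nat := nth 0
  [:: (2 * u + 2) %/ 3; 2 * ((u + 1) %/ 3); (2 * u + 1) %/ 3] (m %% 3).

Lemma lowerD_step m u u' : u' < u <= u'.+2 -> lowerD m u <= (lowerS m u').+1.
Proof.
rewrite /lowerD /lowerS; have : m %% 3 < 3 by rewrite ltn_mod.
by case: (m %% 3) => [|[|[|//]]] _ /=; lia.
Qed.

Lemma lowerS_step m u : lowerS m u.+1 <= (lowerD m u).+1.
Proof.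
rewrite /lowerD /lowerS; have : m %% 3 < 3 by rewrite ltn_mod.
by case: (m %% 3) => [|[|[|//]]] _ /=; lia.
Qed.

Lemma lowerS_le m u : lowerS m u <= (2 * u + 2) %/ 3.
Proof.
rewrite /lowerS; have : m %% 3 < 3 by rewrite ltn_mod.
by case: (m %% 3) => [|[|[|//]]] _ /=; lia.
Qed.

Lemma lowerS_touch m : 1 < m -> lowerS m m <= ((2 * (m - 2) + 1) %/ 3).+1.
Proof.
rewrite /lowerS; have : m %% 3 = m %% 3 by [].
have : m %% 3 < 3 by rewrite ltn_mod.
by case: {1 3 4}(m %% 3) => [|[|[|//]]] _ /=; lia.
Qed.

(** * The covering game with pairs [{x, s x}], for a permutation [s] *)

Section PairCoverGame.

Variables (T : finType) (e : rel T) (s c c' : T -> T).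
Hypothesis s_inj : injective s.
Hypothesis s_neq : forall x, s x != x.
Hypothesis nbhdE : forall x, nbhd e (c x) = [set x; s x].
Hypothesis c'K : cancel c' c.

Implicit Types (A B D E : {set T}) (x y z : T) (k a : nat) (b : bool).

(* The move at the vertex c x covers x and s x. *)
Definition cover D x := s x |: (x |: D).
Definition open D x := (x \notin D) || (s x \notin D).
Definition nfree D := #|~: D|.
(* Its cardinal is the number of maximal runs x, s x, s (s x), ... of uncovered vertices,
   except that an entirely uncovered orbit contributes 0. *)
Definition border D := [set y in D | s y \notin D].
Definition weight D := 2 * nfree D + #|border D|.
(** Since [s] is injective on a finite type, these sets are exactly the unions of orbits. *)
Definition fwd E := forall x, x \in E -> s x \in E.

(** * Effect of a move on the number of uncovered vertices and on the weight *)

Lemma coverE D x : D :|: nbhd e (c x) = cover D x.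
Proof. by rewrite nbhdE /cover setUC -setUA setUCA. Qed.

Lemma legal_cover D x : legal e D (c x) = open D x.
Proof. by rewrite /legal nbhdE subUset !sub1set negb_and. Qed.

Lemma sub_cover D x : D \subset cover D x.
Proof. by rewrite /cover setUA subsetUr. Qed.

Lemma nfree_add D z : z \notin D -> (nfree (z |: D)).+1 = nfree D.
Proof.
move=> zD; rewrite /nfree setCU setIC -setDE (cardsD1 z (~: D)).
by rewrite inE zD.
Qed.

Lemma addK D z : z \in D -> z |: D = D.
Proof. by move=> zD; apply/setUidPr; rewrite sub1set. Qed.

Lemma s_surj z : exists w, s w = z.
Proof. by exists (invF s_inj z); rewrite f_invF. Qed.

(** Covering [z] removes the predecessor [w] from the border if it was there, and adds at most [z]
    itself, namely when [s z] is still uncovered. *)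
Lemma weight_add D z w : z \notin D -> s w = z ->
  weight (z |: D) + 2 + (w \in D) <= weight D + (s z \notin D).
Proof.
move=> zD swz; have := nfree_add zD; rewrite /weight.
suff: #|border (z |: D)| + (w \in D) <= #|border D| + (s z \notin D) by lia.
have sub : border (z |: D) \subset
    (border D :\ w) :|: (if s z \notin D then [set z] else set0).
  apply/subsetP => y; rewrite !inE negb_or => /andP[yzD /andP[syz syD]].
  have yw : y != w by apply: contraNneq syz => ->; apply/eqP.
  case/orP: yzD => [/eqP yz | yD]; last by rewrite yw yD syD.
  by rewrite -yz syD !inE eqxx !orbT.
have := leq_trans (subset_leq_card sub) (leq_card_setU _ _).
have -> : #|if s z \notin D then [set z] else set0| = (s z \notin D).
  by case: ifP; rewrite ?cards1 ?cards0.
rewrite [#|border D|](cardsD1 w) [w \in border D]inE swz zD andbT.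
lia.
Qed.

Lemma nfree_cover D x : open D x ->
  nfree (cover D x) < nfree D /\ nfree D <= (nfree (cover D x)).+2.
Proof.
rewrite /cover /open; have [xD | xD _] /= := boolP (x \in D).
  by rewrite (addK xD) => /nfree_add; lia.
have := nfree_add xD; have [sxD | sxD] := boolP (s x \in x |: D).
  by rewrite (addK sxD); lia.
by have := nfree_add sxD; lia.
Qed.

Lemma nfree_cover_half D x : x \in D -> s x \notin D ->
  (nfree (cover D x)).+1 = nfree D.
Proof. by move=> xD sxD; rewrite /cover (addK xD) nfree_add. Qed.

Lemma weight_cover_free D x : x \notin D -> s x \notin D ->
  weight (cover D x) + 3 <= weight D.
Proof.
move=> xD sxD; have [w sw] := s_surj x.
have sxD' : s x \notin x |: D by rewrite !inE negb_or s_neq.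
have := weight_add xD sw; have := weight_add sxD' (erefl (s x)).
by rewrite sxD !inE eqxx /= /cover; lia.
Qed.

Lemma weight_cover_end D y : y \in D -> s y \notin D -> s (s y) \notin D ->
  weight (cover D (s y)) + 4 <= weight D.
Proof.
move=> yD syD ssyD.
have ssyD' : s (s y) \notin s y |: D by rewrite !inE negb_or s_neq.
have := weight_add syD (erefl (s y)); have := weight_add ssyD' (erefl _).
by rewrite yD ssyD !inE eqxx /= /cover; lia.
Qed.

(** A move that covers a single new vertex has a covered vertex next to it, so the number of runs
    does not grow. *)
Lemma weight_cover D x : open D x -> weight (cover D x) + 2 <= weight D.
Proof.
rewrite /open; have [xD | xD _] /= := boolP (x \in D).
  move=> sxD; have := weight_add sxD (erefl _).
  by rewrite /cover (addK xD) xD; lia.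
have [sxD | sxD] := boolP (s x \in D); last by have := weight_cover_free xD sxD; lia.
have [w sw] := s_surj x; have := weight_add xD sw.
have sxD' : s x \in x |: D by rewrite !inE sxD orbT.
by rewrite /cover (addK sxD') sxD; lia.
Qed.

(* Every run of uncovered vertices is a single vertex, orbits disjoint from D
   excepted. *)
Definition isolated D := forall y, y \in D -> s y \notin D -> s (s y) \in D.

Lemma isolatedP D :
  isolated D \/ exists y, [/\ y \in D, s y \notin D & s (s y) \notin D].
Proof.
have [/existsP[y /and3P[]] | ] :=
    boolP [exists y, [&& y \in D, s y \notin D & s (s y) \notin D]].
  by right; exists y.
rewrite negb_exists => /forallP iso; left => y yD syD.
by have := iso y; rewrite yD syD /= negbK.
Qed.

Lemma isolated_fwd D : isolated D -> fwd (D :|: s @: D).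
Proof.
move=> iso x; rewrite inE => /orP[xD | /imsetP[y yD ->]].
  by rewrite inE imset_f ?orbT.
rewrite [_ \in _ :|: _]inE; have [syD | syD] := boolP (s y \in D).
  by rewrite orbC imset_f.
by rewrite iso.
Qed.

Lemma isolated_cover D x : isolated D -> x \in D -> isolated (cover D x).
Proof.
move=> iso xD y; rewrite /cover (addK xD) !inE => yD.
rewrite !negb_or => /andP[syx syD].
case/predU1P: yD => [yx | yD]; last by rewrite iso ?orbT.
have [sxD|sxD] := boolP (s x \in D); last first.
  by move: syD; rewrite yx iso.
by rewrite iso ?orbT // yx.
Qed.

Lemma border0_fwd D : border D = set0 -> fwd D.
Proof.
by move=> b0 x xD; have := in_set0 x; rewrite -b0 inE xD => /negbFE.
Qed.

(** * One-move recursions for the value of the game *)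

Lemma game0 k b D : nfree D = 0 -> game_val e k b D = 0.
Proof.
move/eqP; rewrite cards_eq0 => /eqP D0; case: k => //= k.
case: existsP => // -[v]; rewrite /legal => /negP[].
by rewrite -[D]setCK D0 setC0 subsetT.
Qed.

Lemma game_no_move k b D : (forall x, ~~ open D x) -> game_val e k b D = 0.
Proof.
move=> nop; case: k => //= k; case: existsP => // -[v].
by rewrite -[v]c'K legal_cover (negbTE (nop _)).
Qed.

Lemma gameD_le k D x a : open D x ->
  game_val e k false (cover D x) <= a -> game_val e k.+1 true D <= a.+1.
Proof.
move=> op le_a /=; case: ifP => // _; rewrite ltnS.
apply: leq_trans le_a; rewrite -coverE.
by apply: (bigmin_leq (fun v => game_val e k false (D :|: nbhd e v)));
  rewrite legal_cover.
Qed.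

Lemma gameS_le k D a :
  (forall x, open D x -> game_val e k true (cover D x) <= a) ->
  game_val e k.+1 false D <= a.+1.
Proof.
move=> le_a /=; case: ifP => // _; rewrite ltnS.
apply/bigmax_leqP => v; rewrite -[v]c'K legal_cover coverE; exact: le_a.
Qed.

Lemma gameS_ge k D x a : open D x ->
  a <= game_val e k true (cover D x) -> a.+1 <= game_val e k.+1 false D.
Proof.
move=> op le_a /=; case: ifP => [_ | /existsP[]]; last first.
  by exists (c x); rewrite legal_cover.
rewrite ltnS; apply: leq_trans le_a _; rewrite -coverE.
by apply: (@leq_bigmax_cond _ _ (fun v => game_val e k true (D :|: nbhd e v)));
  rewrite legal_cover.
Qed.

Lemma game_le_nfree k b D : game_val e k b D <= nfree D.
Proof.
elim: k b D => // k IHk b D.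
have [/existsP[x op] | nop] := boolP [exists x, open D x]; last first.
  by rewrite game_no_move // => x; move: nop; rewrite negb_exists => /forallP.
have [lt0 _] := nfree_cover op; rewrite -(prednK (leq_ltn_trans _ lt0)) //.
case: b; first by apply: gameD_le op _; apply: leq_trans (IHk _ _) _; lia.
apply: gameS_le => y opy; have [lt1 _] := nfree_cover opy.
by apply: leq_trans (IHk _ _) _; lia.
Qed.

Lemma gameD_ge k D a x0 : open D x0 ->
  (forall x, open D x -> a <= game_val e k false (cover D x)) ->
  a.+1 <= game_val e k.+1 true D.
Proof.
move=> op0 ge_a /=; case: ifP => [_ | /existsP[]]; last first.
  by exists (c x0); rewrite legal_cover.
rewrite ltnS; elim/big_ind: _ => [|p q|v].
(* The default [#|T|.+1] of the minimum does no harm: [a] is at most a game value, hence at most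
   [#|T|]. *)
- apply: leq_trans (ge_a _ op0) (leq_trans (game_le_nfree _ _ _) _).
  exact: leq_trans (max_card _) (leqnSn _).
- by rewrite leq_min => -> ->.
- by rewrite -[v]c'K legal_cover coverE; apply: ge_a.
Qed.

(* A is contained in the union of the s-orbits that meet D. *)
Definition spans D A := forall E, fwd E -> D \subset E -> A \subset E.

Lemma spansS D D' A : D \subset D' -> spans D A -> spans D' A.
Proof. by move=> sDD' spA E fE sE; apply: spA fE (subset_trans sDD' sE). Qed.

Lemma spans_cover D x A : spans D A -> spans (cover D x) A.
Proof. exact: spansS (sub_cover D x). Qed.

Lemma nfree_gt0 D : 0 < nfree D -> exists x, open D x.
Proof.
by case/card_gt0P => x; rewrite inE => xD; exists x; rewrite /open xD.
Qed.

(** Outside [B] every uncovered vertex is a run of its own, so [s] maps the border bijectively onto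
    these vertices. *)
Lemma card_border D B : (forall x, (s x \in B) = (x \in B)) ->
  D \subset ~: B -> spans D (~: B) -> isolated D ->
  #|border D| + #|B| = nfree D.
Proof.
move=> sB DB spD iso.
have defB : s @: border D = ~: D :\: B.
  apply/setP => z; apply/imsetP/idP => [[y] | ].
    rewrite !inE => /andP[yD syD] ->; rewrite syD andbT sB.
    by have := subsetP DB y yD; rewrite inE.
  rewrite !inE => /andP[zB zD].
  have := spD _ (isolated_fwd iso) (subsetUl _ _).
  move/subsetP/(_ z); rewrite !inE zB (negbTE zD) /= => /(_ isT)/imsetP[y yD zE].
  by exists y; rewrite // inE yD -zE.
rewrite -(card_imset _ s_inj) defB /nfree -(cardsID B (~: D)) addnC.
by congr (_ + _); apply/eq_card => x; rewrite !inE; have := subsetP DB x;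
  rewrite !inE; case: (x \in D); case: (x \in B) => // /(_ isT).
Qed.

Lemma spans_border D : spans D setT -> 0 < nfree D ->
  exists2 y, y \in D & s y \notin D.
Proof.
move=> spD; case/card_gt0P => z; rewrite inE => zD.
have [b0 | [y]] := set_0Vmem (border D).
  have := subsetP (spD _ (border0_fwd b0) (subxx _)) z.
  by rewrite inE (negbTE zD) => /(_ isT).
by rewrite inE => /andP[]; exists y.
Qed.

(** * Positions in which every orbit has been opened *)

Lemma game_le_spans k D : spans D setT -> nfree D <= k ->
  game_val e k true D <= weight D %/ 3 /\
  game_val e k false D <= (weight D + 1) %/ 3.
Proof.
elim: k D => // k IHk D spD lek.
have [/eqP U0 | U_gt0] := posnP (nfree D).
  by rewrite !game0 //; apply/eqP.
have [x0 op0] := nfree_gt0 U_gt0.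
have [y0 y0D sy0D] := spans_border spD U_gt0.
(* Keeps the subtractions from the weight below from truncating. *)
have w3 : 3 <= weight D.
  suff : 0 < #|border D| by rewrite /weight; lia.
  by apply/card_gt0P; exists y0; rewrite inE y0D.
split.
  have -> : weight D %/ 3 = ((weight D - 3) %/ 3).+1 by lia.
  case: (isolatedP D) => [iso | [y [yD syD ssyD]]].
    (* Here the weight is three times the number of uncovered vertices, and each move covers at
       least one of them. *)
    have := card_border (B := set0) _ _ _ iso.
    rewrite setC0 cards0 subsetT => /(_ _ isT spD) bE.
    have {}bE : #|border D| + 0 = nfree D by apply: bE => x; rewrite !inE.
    apply: leq_trans (game_le_nfree _ _ _) _.
    by move: w3 bE; rewrite /weight; lia.
  have op : open D (s y) by rewrite /open syD.
  apply: (gameD_le op).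
  have [lt_U _] := nfree_cover op; have := weight_cover_end yD syD ssyD.
  have [|_] := IHk _ (spans_cover (x := s y) spD); lia.
have -> : (weight D + 1) %/ 3 = ((weight D - 2) %/ 3).+1 by lia.
apply: gameS_le => x op.
have [lt_U _] := nfree_cover op; have := weight_cover op.
have [|] := IHk _ (spans_cover (x := x) spD); lia.
Qed.

(** Dominator covers at most two vertices per move, and Staller always finds a border vertex at
    which to cover just one: three vertices per round. *)
Lemma game_ge_spans k D : spans D setT -> nfree D <= k ->
  (2 * nfree D + 1) %/ 3 <= game_val e k true D /\
  (2 * nfree D + 2) %/ 3 <= game_val e k false D.
Proof.
elim: k D => [|k IHk] D spD lek; first by lia.
have [U0 | U_gt0] := posnP (nfree D); first by rewrite U0.
split.
  have -> : (2 * nfree D + 1) %/ 3 = ((2 * (nfree D - 1)) %/ 3).+1 by lia.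
  have [x0 op0] := nfree_gt0 U_gt0.
  apply: (gameD_ge op0) => x op; have [lt_U le_U] := nfree_cover op.
  have [|_] := IHk _ (spans_cover (x := x) spD); lia.
have [y yD syD] := spans_border spD U_gt0.
have -> : (2 * nfree D + 2) %/ 3 = ((2 * (nfree D - 1) + 1) %/ 3).+1 by lia.
have op : open D y by rewrite /open syD orbT.
have U_y := nfree_cover_half yD syD; apply: (gameS_ge op).
have [|] := IHk _ (spans_cover (x := y) spD); lia.
Qed.

(** * The initial positions, and the values for a single orbit *)

Lemma nfree0 : nfree set0 = #|T|.
Proof. by rewrite /nfree setC0 cardsT. Qed.

Lemma weight0 : weight set0 = 2 * #|T|.
Proof.
rewrite /weight nfree0 (_ : border set0 = set0) ?cards0 ?addn0 //.
by apply/setP => x; rewrite !inE.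
Qed.

Lemma nfree_set1 v : nfree [set v] = #|T| - 1.
Proof. by rewrite /nfree cardsC1 subn1. Qed.

Lemma weight_set1 v : weight [set v] + 1 <= 2 * #|T|.
Proof.
have [w sw] := s_surj v; have v0 : v \notin set0 by rewrite inE.
by have := weight_add v0 sw; rewrite setU0 weight0 !inE; lia.
Qed.

Lemma weight_cover0 x : weight (cover set0 x) + 3 <= 2 * #|T|.
Proof. by rewrite -weight0; apply: weight_cover_free; rewrite inE. Qed.

Lemma open0 x : open set0 x.
Proof. by rewrite /open inE. Qed.

Lemma nfree_cover0 x :
  nfree (cover set0 x) < #|T| <= (nfree (cover set0 x)).+2.
Proof. by rewrite -nfree0; apply/andP/nfree_cover/open0. Qed.

Lemma spans_cover0 x A : spans [set x] A -> spans (cover set0 x) A.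
Proof. by apply: spansS; rewrite /cover sub1set !inE eqxx orbT. Qed.

Lemma gamma_le x : spans [set x] setT -> gamma_tg e <= (2 * #|T| + 1) %/ 3.
Proof.
move=> /spans_cover0 sp; have := weight_cover0 x; have := nfree_cover0 x.
rewrite /gamma_tg /gamma_tg_part; case: #|T| => // k lt_U lew.
apply: leq_trans (gameD_le (open0 x) (leqnn _)) _.
by have [|_] := game_le_spans (k := k) sp; lia.
Qed.

Lemma gamma_ge : (forall x, spans [set x] setT) ->
  (2 * #|T| + 1) %/ 3 <= gamma_tg e.
Proof.
move=> sp; rewrite /gamma_tg /gamma_tg_part.
have [T0 | /card_gt0P[x0 _]] := posnP #|T|; first by rewrite T0.
have lt_U x := nfree_cover0 x.
case: #|T| lt_U => // k lt_U.
have -> : (2 * k.+1 + 1) %/ 3 = ((2 * k) %/ 3).+1 by lia.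
apply: (gameD_ge (open0 x0)) => x _.
have [|_] := game_ge_spans (k := k) (spans_cover0 (sp x)); have := lt_U x; lia.
Qed.

Lemma gamma_part_le v : spans [set v] setT ->
  gamma_tg_part e [set v] <= (2 * #|T| - 1) %/ 3.
Proof.
move=> sp; have [|le_w _] := game_le_spans (k := #|T|) sp; first exact: max_card.
by apply: leq_trans le_w _; have := weight_set1 v; lia.
Qed.

Lemma gamma_part_ge v : spans [set v] setT ->
  (2 * (#|T| - 1) + 1) %/ 3 <= gamma_tg_part e [set v].
Proof.
move=> sp; rewrite -(nfree_set1 v).
by have [|] := game_ge_spans (k := #|T|) sp; rewrite ?max_card.
Qed.

(** * Positions with exactly one unopened orbit [B] *)

Section UntouchedOrbit.

Variables (B : {set T}) (b0 : T).
Hypothesis sB : forall x, (s x \in B) = (x \in B).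
Hypothesis b0B : b0 \in B.
Hypothesis spansB : forall x, x \in B -> spans [set x] B.

Definition untouched D := D \subset ~: B /\ spans D (~: B).

Lemma untouched_free D x : untouched D -> x \in B -> x \notin D.
Proof. by case=> DB _; apply: contraL => /(subsetP DB); rewrite inE. Qed.

Lemma untouched_open D x : untouched D -> x \in B -> open D x.
Proof. by move=> uD /(untouched_free uD) xD; rewrite /open xD. Qed.

(** Opening [B] leads back to the positions with all orbits opened, whose bounds then apply. *)
Lemma touch_spans D x : untouched D -> x \in B -> spans (cover D x) setT.
Proof.
move=> [_ spD] xB E fE sE; rewrite -(setUCr B) subUset.
rewrite (spans_cover spD fE sE) andbT.
apply: (spansB xB fE); apply: subset_trans sE.
by rewrite sub1set /cover !inE eqxx orbT.
Qed.

Lemma untouched_cover D x : untouched D -> x \notin B -> untouched (cover D x).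
Proof.
move=> [DB spD] xB; split; last exact: spans_cover.
by rewrite /cover !subUset !sub1set !inE sB xB.
Qed.

Lemma touch_weight D x : untouched D -> x \in B ->
  weight (cover D x) + 3 <= weight D.
Proof.
by move=> uD xB; apply: weight_cover_free; rewrite (untouched_free uD) ?sB.
Qed.

Lemma untouched_nfree D : untouched D -> 2 <= nfree D.
Proof.
move=> uD; have <- : #|[set b0; s b0]| = 2 by rewrite cards2 eq_sym s_neq.
apply/subset_leq_card/subsetP => x.
by rewrite !inE => /orP[] /eqP ->; rewrite (untouched_free uD) ?sB.
Qed.

(** Such a move fills a run of length one, so both the vertex and its run disappear. *)
Lemma isolated_cover_weight D x : untouched D -> isolated D -> x \notin B ->
  open D x -> weight (cover D x) + 3 <= weight D.
Proof.
move=> uD iso xB; rewrite /open; have [xD /= sxD | xD _] := boolP (x \in D).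
  have := weight_add sxD (erefl _).
  by rewrite /cover (addK xD) xD (iso _ xD sxD) /=; lia.
have /imsetP[w wD xE] : x \in s @: D.
  have /subsetP/(_ x) := uD.2 _ (isolated_fwd iso) (subsetUl _ _).
  by rewrite !inE xB (negbTE xD); apply.
have sxD : s x \in D by rewrite xE iso // -xE.
have sxD' : s x \in x |: D by rewrite inE sxD orbT.
by have := weight_add xD (esym xE); rewrite /cover (addK sxD') wD sxD /=; lia.
Qed.

(** Induction over rounds of two moves. Dominator shortens a long run if there is one, otherwise
    fills a single gap, and opens [B] only when nothing else is left. A round outside [B] lowers the
    weight by at least 6; if Staller opens [B], the bound for opened orbits takes over. *)
Lemma gameD_le_untouched k D : untouched D -> nfree D <= k ->
  game_val e k true D <= upper #|B| (weight D).
Proof.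
elim/ltn_ind: k D => -[|[|k]] IHk D uD lek; first by [].
  by have := untouched_nfree uD; lia.
have le_reply D1 x : untouched D1 -> nfree D1 <= k.+1 -> open D1 x ->
    x \notin B -> weight (cover D1 x) + 6 <= weight D ->
    game_val e k true (cover D1 x) <= upper #|B| (weight D - 6).
  move=> u1 le1 op xB lew; have [lt_U _] := nfree_cover op.
  have lek1 : nfree (cover D1 x) <= k by lia.
  apply: leq_trans (IHk _ _ _ (untouched_cover u1 xB) lek1) _; first by lia.
  by apply: upper_mono; lia.
have le_touch D1 x : untouched D1 -> nfree D1 <= k.+1 -> x \in B ->
    game_val e k true (cover D1 x) <= weight (cover D1 x) %/ 3.
  move=> u1 le1 xB; have [lt_U _] := nfree_cover (untouched_open u1 xB).
  by have [|] := game_le_spans (k := k) (touch_spans u1 xB); lia.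
have upper6 : 6 <= weight D ->
    upper #|B| (weight D) = (upper #|B| (weight D - 6)).+2.
  by move=> w6; rewrite -upper_add6 subnK.
case: (isolatedP D) => [iso | [y [yD syD ssyD]]]; last first.
  have op : open D (s y) by rewrite /open syD.
  have syB : s y \notin B.
    by rewrite sB; have := subsetP uD.1 _ yD; rewrite inE.
  have u1 := untouched_cover uD syB.
  have [lt_U _] := nfree_cover op; have w1 := weight_cover_end yD syD ssyD.
  (* A hypothetical move at [b0] shows that the weight is at least 6. *)
  have w2 := touch_weight u1 b0B.
  rewrite upper6; last by lia.
  apply: (gameD_le op); apply: gameS_le => x opx.
  have [xB | xB] := boolP (x \in B).
    apply: leq_trans (le_touch _ _ u1 _ xB) _; first by lia.
    apply: leq_trans (upper_ge _ _); have := touch_weight u1 xB; lia.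
  apply: le_reply => //; first by lia.
  by have := weight_cover opx; lia.
have bE := card_border sB uD.1 uD.2 iso.
have [bd0 | [y]] := set_0Vmem (border D).
  have wE : weight D = 2 * #|B| by rewrite /weight -bE bd0 cards0; lia.
  rewrite wE; apply: leq_trans (upper_double _).
  have w1 := touch_weight uD b0B; rewrite wE in w1.
  have -> : (2 * #|B| + 1) %/ 3 = ((2 * #|B| - 2) %/ 3).+1 by lia.
  have op := untouched_open uD b0B; apply: (gameD_le op).
  have [lt_U _] := nfree_cover op.
  have [|_] := game_le_spans (k := k.+1) (touch_spans uD b0B); lia.
(* Dominator fills a gap. The runs outside [B] stay single, so a reply there also lowers the weight
   by 3. *)
rewrite inE => /andP[yD syD].
have op : open D y by rewrite /open syD orbT.
have yB : y \notin B by have := subsetP uD.1 _ yD; rewrite inE.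
have u1 := untouched_cover uD yB; have iso1 := isolated_cover iso yD.
have [lt_U _] := nfree_cover op; have w1 := isolated_cover_weight uD iso yB op.
have w2 := touch_weight u1 b0B.
rewrite upper6; last by lia.
apply: (gameD_le op); apply: gameS_le => x opx.
have [xB | xB] := boolP (x \in B).
  apply: leq_trans (le_touch _ _ u1 _ xB) _; first by lia.
  apply: (@leq_trans ((weight D - 6) %/ 3)).
    by have := touch_weight u1 xB; lia.
  (* The weight equals [3 * #|border D| + 2 * #|B|], which gives the congruence. *)
  by apply: upper_ge_mod; move: upper6 w1 w2; rewrite /weight -bE; lia.
apply: le_reply => //; first by lia.
by have := isolated_cover_weight u1 iso1 xB opx; lia.
Qed.

Lemma gameS_le_untouched k D : untouched D -> nfree D <= k.+1 ->
  game_val e k.+1 false D <=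
    (maxn (upper #|B| (weight D - 2)) ((weight D - 3) %/ 3)).+1.
Proof.
move=> uD lek; apply: gameS_le => x op; have [lt_U _] := nfree_cover op.
rewrite leq_max; have [xB | xB] := boolP (x \in B); apply/orP.
  right; have := touch_weight uD xB.
  by have [|] := game_le_spans (k := k) (touch_spans uD xB); lia.
left; have u1 := untouched_cover uD xB.
apply: leq_trans (gameD_le_untouched u1 _) _; first by lia.
by apply: upper_mono; have := weight_cover op; lia.
Qed.

(** Staller covers a single vertex as long as the border is nonempty. Once it is empty, exactly [B]
    is uncovered and Staller has to open it, which costs two vertices. *)
Lemma game_ge_untouched k D : untouched D -> nfree D <= k ->
  lowerD #|B| (nfree D) <= game_val e k true D /\
  lowerS #|B| (nfree D) <= game_val e k false D.
Proof.
elim: k D => [|k IHk] D uD lek; first by have := untouched_nfree uD; lia.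
split.
  have op0 := untouched_open uD b0B.
  case E: (lowerD _ _) => [//|v]; apply: (gameD_ge op0) => x op.
  have /andP/(lowerD_step #|B|) := nfree_cover op; rewrite E ltnS => le_v.
  apply: leq_trans le_v _; have [lt_U _] := nfree_cover op.
  have [xB | xB] := boolP (x \in B).
    apply: leq_trans (lowerS_le _ _) _.
    by have [|_] := game_ge_spans (k := k) (touch_spans uD xB); lia.
  by have [|_] := IHk _ (untouched_cover uD xB); lia.
have [bd0 | [y]] := set_0Vmem (border D).
  have DE : D = ~: B.
    by apply/eqP; rewrite eqEsubset uD.1 (uD.2 _ (border0_fwd bd0)).
  have UE : nfree D = #|B| by rewrite /nfree DE setCK.
  have U2 := untouched_nfree uD; rewrite UE.
  apply: leq_trans (lowerS_touch _) _; first by rewrite -UE.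
  have op := untouched_open uD b0B; have := nfree_cover op.
  case=> lt_U le_U; apply: (gameS_ge op).
  by have [|] := game_ge_spans (k := k) (touch_spans uD b0B); lia.
rewrite inE => /andP[yD syD].
have yB : y \notin B by have := subsetP uD.1 _ yD; rewrite inE.
have op : open D y by rewrite /open syD orbT.
have UE := nfree_cover_half yD syD; rewrite -UE.
apply: leq_trans (lowerS_step _ _) _; apply: (gameS_ge op).
by have [|] := IHk _ (untouched_cover uD yB); lia.
Qed.

Lemma untouched_cover0 x : untouched [set x] -> untouched (cover set0 x).
Proof.
move=> [xB sp]; move: xB; rewrite sub1set inE => xB.
by split; [rewrite /cover !subUset !sub1set sub0set !inE sB xB | exact: spans_cover0].
Qed.

Lemma gamma_part_le_untouched v : untouched [set v] ->
  gamma_tg_part e [set v] <= upper #|B| (2 * #|T| - 1).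
Proof.
move=> uv; apply: leq_trans (gameD_le_untouched uv (max_card _)) _.
by apply: upper_mono; have := weight_set1 v; lia.
Qed.

Lemma gamma_part_ge_untouched v : untouched [set v] ->
  lowerD #|B| (#|T| - 1) <= gamma_tg_part e [set v].
Proof.
by move=> uv; rewrite -(nfree_set1 v); case: (game_ge_untouched uv (max_card _)).
Qed.

(** The first move lowers the weight [2 * #|T|] by at least 3; Staller's reply lowers it by at least
    2 outside [B] and by at least 3 inside, whence 5 and 6. *)
Lemma gamma_le_untouched x : untouched [set x] ->
  gamma_tg e <=
    (maxn (upper #|B| (2 * #|T| - 5)) ((2 * #|T| - 6) %/ 3)).+2.
Proof.
move=> /untouched_cover0 ux; have lew := weight_cover0 x.
have := nfree_cover0 x; have := untouched_nfree ux.
rewrite /gamma_tg /gamma_tg_part; case: #|T| lew => [|[|k]] lew; try lia.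
move=> _ lt_U; apply: (gameD_le (open0 x)).
apply: leq_trans (gameS_le_untouched ux _) _; first by lia.
rewrite ltnS geq_max; apply/andP; split; rewrite leq_max.
  by rewrite upper_mono //; lia.
by apply/orP; right; lia.
Qed.

End UntouchedOrbit.

End PairCoverGame.

(** * The cycle as a pair covering game, with [s] the shift by two *)

Section Cycle.

Variable n : nat.
Hypothesis n_gt2 : 2 < n.

Definition step2 (i : 'I_n) : 'I_n := ordS (ordS i).

Lemma step2E (i : 'I_n) : step2 i = (i + 2) %% n :> nat.
Proof. by rewrite /step2 /= -addn1 modnDml addn1 addn2. Qed.

Lemma step2_inj : injective step2.
Proof. exact: inj_comp (@ordS_inj n) (@ordS_inj n). Qed.

Lemma step2_neq (i : 'I_n) : step2 i != i.
Proof.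
apply/eqP => /(congr1 (@nat_of_ord n)); rewrite step2E -[RHS](modn_small (ltn_ord i)).
rewrite -[in RHS](addn0 i) => /eqP; rewrite eqn_modDl mod0n modn_small //.
Qed.

Lemma nbhd_cycle (i : 'I_n) : nbhd (cycle_rel n) (ordS i) = [set i; step2 i].
Proof.
apply/setP => j; rewrite !inE /cycle_rel orbC.
have -> : (val (ordS i) == (val j).+1 %% n) = (ordS i == ordS j) by [].
by rewrite (inj_eq (@ordS_inj n)) eq_sym.
Qed.

Lemma step2_iter (k : nat) (i : 'I_n) : iter k step2 i = (i + 2 * k) %% n :> nat.
Proof.
elim: k => [|k IHk]; first by rewrite muln0 addn0 modn_small.
by rewrite iterS step2E IHk modnDml mulnSr addnA.
Qed.

Lemma step2_reach (i j : 'I_n) : odd n || (odd i == odd j) ->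
  exists k, iter k step2 i = j.
Proof.
move=> par; have [lei lej] := (ltn_ord i, ltn_ord j).
have [k [q kE]] : exists k q, i + 2 * k = q * n + j.
  (* The distance must be even. If it is odd after one turn, [n] is odd and a further turn corrects
     the parity. *)
  have [ev | od] := boolP (odd (j + n - i)).
    by exists ((j + n + n - i)./2), 2; lia.
  by exists ((j + n - i)./2), 1; lia.
by exists k; apply: val_inj; rewrite /= step2_iter kE modnMDl modn_small.
Qed.

Lemma spans_cycle (i : 'I_n) (A : {set 'I_n}) :
  (forall j, j \in A -> odd n || (odd i == odd j)) -> spans step2 [set i] A.
Proof.
move=> parA E fE iE; apply/subsetP => j /parA/step2_reach[k <-].
by elim: k => [|k IHk]; [rewrite -sub1set | apply: fE].
Qed.

(** * Even cycles: the two parity classes are the two orbits *)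

Definition coclass (v : 'I_n) : {set 'I_n} := [set j : 'I_n | odd j != odd v].

Hypothesis n_even : ~~ odd n.

Lemma step2_coclass (v i : 'I_n) : (step2 i \in coclass v) = (i \in coclass v).
Proof. by rewrite !inE step2E odd_mod ?(negbTE n_even) // oddD addbF. Qed.

Lemma ordS_coclass (v i : 'I_n) : (ordS i \in coclass v) = (i \notin coclass v).
Proof. by rewrite !inE /= odd_mod ?(negbTE n_even) //=; do 2!case: odd. Qed.

(** The rotation by one exchanges the two parity classes. *)
Lemma card_coclass (v : 'I_n) : #|coclass v| = n./2.
Proof.
have eqC : (@ordS n) @: coclass v = ~: coclass v.
  apply/setP => j; rewrite -[j](ord_predK j) inE -ordS_coclass.
  by rewrite mem_imset ?ordS_coclass ?negbK //; apply: ordS_inj.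
have := cardsC (coclass v); rewrite -eqC card_imset ?card_ord; last exact: ordS_inj.
by rewrite addnn => /(congr1 half); rewrite doubleK.
Qed.

Lemma ordS_in_coclass (v : 'I_n) : ordS v \in coclass v.
Proof. by rewrite ordS_coclass !inE eqxx. Qed.

Lemma spans_coclass (v i : 'I_n) :
  i \in coclass v -> spans step2 [set i] (coclass v).
Proof.
rewrite inE => iv; apply: spans_cycle => j; rewrite inE => jv.
by rewrite orbC; move: iv jv; do 3!case: odd.
Qed.

Lemma untouched_set1 (v : 'I_n) : untouched step2 (coclass v) [set v].
Proof.
split; first by rewrite sub1set !inE eqxx.
by apply: spans_cycle => j; rewrite !inE negbK orbC eq_sym => ->.
Qed.

Lemma gamma_cycle_ge : n %% 3 = 0 -> (2 * n) %/ 3 <= gamma_tg (cycle_rel n).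
Proof.
move=> n3; rewrite /gamma_tg /gamma_tg_part card_ord.
have n_gt0 : 0 < n by lia.
have -> : 2 * n %/ 3 = (2 * n %/ 3 - 1).+1 by lia.
have -> : game_val (cycle_rel n) n = game_val (cycle_rel n) n.-1.+1.
  by rewrite prednK.
apply: (gameD_ge nbhd_cycle (@ord_predK n) (open0 _ (Ordinal n_gt0))).
move=> x _; have := nfree_cover0 step2 x; rewrite card_ord => leU.
(* Any first move leaves one of the two orbits unopened. *)
have uD := untouched_cover0 (step2_coclass x) (untouched_set1 x).
have [|_] := game_ge_untouched (k := n.-1) step2_neq nbhd_cycle
  (@ord_predK n) (step2_coclass x) (ordS_in_coclass x) (@spans_coclass x) uD.
  by lia.
have m3 : n./2 %% 3 = 0 by lia.
by rewrite card_coclass /lowerS m3 /=; lia.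
Qed.

End Cycle.

(** * Comparison of the bounds by the residue of [n] modulo 6 *)

Theorem theorem2p1 (n : nat) :
  3 <= n ->
  (gamma_tg_critical (cycle_rel n) <-> n %% 6 \in [:: 0; 1; 3]).
Proof.
move=> n_gt2; have n_gt0 : 0 < n by lia.
pose v0 := Ordinal n_gt0.
have [n_odd | n_even] := boolP (odd n).
  have sp v : spans (@step2 n) [set v] setT.
    by apply: spans_cycle => // j _; rewrite n_odd.
  have le_g := gamma_le (@step2_inj n) (step2_neq n_gt2) (@nbhd_cycle n)
    (@ord_predK n) (sp v0).
  have ge_g := gamma_ge (@nbhd_cycle n) (@ord_predK n) sp.
  have ge_p := gamma_part_ge (@nbhd_cycle n) (@ord_predK n) (sp v0).
  rewrite card_ord in le_g ge_g ge_p.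
  (* The values are [(2 * n + 1) %/ 3] and [(2 * n - 1) %/ 3]; they coincide exactly when [n] is 2
     modulo 3. *)
  split=> [/(_ v0) | n6 v].
    by rewrite !inE; lia.
  have := gamma_part_le (@step2_inj n) (step2_neq n_gt2) (@nbhd_cycle n)
    (@ord_predK n) (sp v).
  by rewrite card_ord; move: n6; rewrite !inE; lia.
have uv v := untouched_set1 n_gt2 v.
have sB v := step2_coclass n_even v.
have bB v := ordS_in_coclass n_even v.
have spB v := @spans_coclass n n_gt2 v.
split=> [/(_ v0) | n6 v].
  have le_g := gamma_le_untouched (@step2_inj n) (step2_neq n_gt2)
    (@nbhd_cycle n) (@ord_predK n) (sB v0) (bB v0) (spB v0) (uv v0).
  have ge_p := gamma_part_ge_untouched (step2_neq n_gt2)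
    (@nbhd_cycle n) (@ord_predK n) (sB v0) (bB v0) (spB v0) (uv v0).
  rewrite card_ord card_coclass // in le_g ge_p.
  move=> lt_pg; have {lt_pg ge_p le_g} := leq_trans (leq_ltn_trans ge_p lt_pg) le_g.
  (* For residues 2 and 4 the lower bound after declaring [v0] equals the upper bound for the whole
     cycle, contradicting strictness. *)
  have [n6|[n6|n6]] : n %% 6 = 0 \/ n %% 6 = 2 \/ n %% 6 = 4 by lia.
  - by rewrite n6.
  - have m3 : n./2 %% 3 = 1 by lia.
    by rewrite /lowerD /upper m3 /=; lia.
  - have m3 : n./2 %% 3 = 2 by lia.
    by rewrite /lowerD /upper m3 /=; lia.
have {}n6 : n %% 6 = 0 by move: n6; rewrite !inE; lia.
have := gamma_part_le_untouched (@step2_inj n) (step2_neq n_gt2)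
  (@nbhd_cycle n) (@ord_predK n) (sB v) (bB v) (spB v) (uv v).
have ge_g := gamma_cycle_ge n_gt2 n_even.
have m3 : n./2 %% 3 = 0 by lia.
rewrite card_ord card_coclass // /upper m3 /=; lia.
Qed.
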